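(* Let $\mathcal{O}$ be a finite set of objects with schema projection $\Pi:\mathcal{O}\to\mathcal{Z}$, let $D^*$ be a set of schema fields, and let $O$ be an $\mathcal{O}$-valued random variable with prior law $\mu$. Suppose the adversary observes the restriction $x := z^*|_{D^*}$ of the projection $z^*=\Pi(o^* )$ of the target object $o^*$ to the disclosed fields $D^*$, where $\sum_{f\in D^*} w_f\le \tau(o^* )$, together with side information given by a random variable $\mathcal{I}$. Assume: 1. the prior $\mu$ is uniform within each equivalence class, i.e. conditional on $\Pi(O)|_{D^*}=x$, every object in $\mathrm{EC}(x,D^* )$ is equally likely a priori; 2. $\mathcal{I}$ satisfies the bounded-likelihood-ratio condition with constant $\eta\ge 1$: for every disclosed pattern $x$ on $D^*$, all $o,o'\in \mathrm{EC}(x,D^* )$, and every realization $i$ of $\mathcal{I}$, $$\frac{\Pr[\mathcal{I}=i\mid O=o]}{\Pr[\mathcal{I}=i\mid O=o']}\le \eta .$$ If $|\mathrm{EC}(z^*,D^* )|\ge k$, then for any adversary $\mathcal{A}$, $$\Pr[\mathcal{A}(z^*|_{D^*},\mathcal{I})=o^*]\le \frac{\eta}{\eta+k-1}.$$ Equivalently, $\Pr[\mathcal{A}(z^*|_{D^*},\mathcal{I})=o^*]\le \frac1k+\delta$, where $$\delta:=\frac{\eta}{\eta+k-1}-\frac1k=\frac{(\eta-1)(k-1)}{k(\eta+k-1)}.$$ Here the target $o^*$ is the realization of $O$, and the probability is over $O$, $\mathcal{I}$ (and any randomness of $\mathcal{A}$) conditional on the observed pattern $\Pi(O)|_{D^*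}=x$.
   Context: $\mathcal{O}=\{o_1,\dots,o_n\}$ is the finite set of real-world objects. The schema projection $\Pi$ maps each object to a tuple in a finite attribute space $$\mathcal{Z}=\mathcal{K}\times\mathcal{S}\times 2^{\mathcal{T}}\times 2^{\mathcal{U}}\times\mathcal{F}\times\mathcal{R},$$ where $\mathcal{K}$ (kind labels, $|\mathcal{K}|=6$), $\mathcal{S}$ (semantic classes), $\mathcal{T}$ (content tags), $\mathcal{U}$ (usability tags), $\mathcal{F}$ (freshness buckets, $|\mathcal{F}|=3$) and $\mathcal{R}$ (sensitivity levels, $|\mathcal{R}|=3$) are finite sets. The coordinates of this product are called fields. For a set $D$ of fields and $z\in\mathcal{Z}$, $z|_D$ is the restriction of $z$ to the coordinates in $D$; a disclosed pattern on $D$ is a value $x=\Pi(o)|_D$ for some $o\in\mathcal{O}$. The equivalence class is $$\mathrm{EC}(z,D)=\{o'\in\mathcal{O}\mid \Pi(o')|_D=z|_D\},$$ and likewise $\mathrm{EC}(x,D)=\{o'\in\mathcal{O}\mid \Pi(o')|_D=x\}$ for a pattern $x$ on $D$. Each field $f$ has a disclosure cost $w_f$, and each object $o$ has a disclosure threshold (budget) $\tau(o)$. An adversary $\mathcal{A}$ is any (possibly randomized, using independent randomness) map taking the disclosed pattern and the realization of $\mathcal{I}$ to a guess in $\mathcal{O}$. $\mathcal{I}$ is a discrete random variable jointly distributed with $O$. Likelihood-ratio inequalities $a/b\le\eta$ are read as $a\le \eta b$. *)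

(* Defs.v *)
From HB Require Import structures.
From mathcomp Require Import all_boot all_order all_algebra.
From mathcomp Require Import all_classical all_reals all_analysis.

Set Implicit Arguments.
Unset Strict Implicit.
Unset Printing Implicit Defensive.

Import Order.TTheory GRing.Theory Num.Theory.

Local Open Scope classical_set_scope.
Local Open Scope ring_scope.

Inductive field :=
  kind | semantic_class | content_tags | usability_tags | freshness
| sensitivity.

Definition field_code (f : field) : 'I_6 :=
  match f with
  | kind => inord 0 | semantic_class => inord 1 | content_tags => inord 2
  | usability_tags => inord 3 | freshness => inord 4 | sensitivity => inord 5
  end.

Definition field_decode (i : 'I_6) : field :=
  nth kind [:: kind; semantic_class; content_tags; usability_tags; freshness;
               sensitivity] i.

Lemma field_codeK : cancel field_code field_decode.
Proof. by case; rewrite /field_decode /field_code inordK. Qed.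

HB.instance Definition _ := Finite.copy field (can_type field_codeK).

Section schema.
Variables K S T U F L : finType.

Definition schema : finType := (K * S * {set T} * {set U} * F * L)%type.

(* A partial tuple: [None] marks an undisclosed field, so [disclose D] retains
   exactly the coordinates in [D]. *)
Definition pattern : finType :=
  (option K * option S * option {set T} * option {set U} * option F
   * option L)%type.

Definition disclose (D : {set field}) (z : schema) : pattern :=
  let: (zk, zs, zt, zu, zf, zl) := z in
  ( if kind \in D then Some zk else None,
    if semantic_class \in D then Some zs else None,
    if content_tags \in D then Some zt else None,
    if usability_tags \in D then Some zu else None,
    if freshness \in D then Some zf else None,
    if sensitivity \in D then Some zl else None ).

Variables (obj : finType) (Pi : obj -> schema).

Definition disclosed_pattern (D : {set field}) (x : pattern) : Prop :=
  exists o : obj, x = disclose D (Pi o).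

Definition ECpat (x : pattern) (D : {set field}) : {set obj} :=
  [set o : obj | disclose D (Pi o) == x]%SET.

Definition EC (z : schema) (D : {set field}) : {set obj} :=
  ECpat (disclose D z) D.

End schema.

(* A random variable with countably many values, for the discrete sigma-algebra
   on its codomain. *)
Definition discrete_RV (d : measure_display) (Omega : measurableType d)
    (T : Type) (X : Omega -> T) : Prop :=
  countable (range X) /\ forall t : T, measurable (X @^-1` [set t]).

Definition law (R : realType) (Omega T : Type) (P : set Omega -> \bar R)
    (X : Omega -> T) : set T -> \bar R := fun A => P (X @^-1` A).

(* Pr[A | B]; it takes the value 0 when B is a null event. *)
Definition cprob (R : realType) (T : Type) (P : set T -> \bar R)
    (A B : set T) : R :=
  fine (P (A `&` B)) / fine (P B).

(* Independence of a discrete random variable [X] and a random variable [Y]; for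
   discrete [X] every event [X @^-1` A] is measurable. *)
Definition independent_of_discrete (d d' : measure_display)
    (Omega : measurableType d) (T : Type) (W : measurableType d')
    (R : realType) (P : probability Omega R) (X : Omega -> T) (Y : Omega -> W) :
    Prop :=
  forall (A : set T) (B : set W), measurable B ->
  P (X @^-1` A `&` Y @^-1` B) = (P (X @^-1` A) * P (Y @^-1` B))%E.

Section assumptions.
Variables (K S T U F L obj : finType) (Pi : obj -> schema K S T U F L).
Variables (D : {set field}) (R : realType).

Definition uniform_within_EC (mu : set obj -> \bar R) : Prop :=
  forall x, disclosed_pattern Pi D x ->
  forall o o', o \in ECpat Pi x D -> o' \in ECpat Pi x D ->
  let B := [set a | disclose D (Pi a) = x] in
  cprob mu [set o] B = cprob mu [set o'] B.

(* If an object of a class is null then, for a law of [O] that is uniform within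
   classes, the whole class is null and the inequality reads 0 <= 0 there. *)
Definition bounded_likelihood_ratio (Omega : Type) (P : set Omega -> \bar R)
    (J : Type) (O : Omega -> obj) (I : Omega -> J) (eta : R) : Prop :=
  forall x, disclosed_pattern Pi D x ->
  forall o o', o \in ECpat Pi x D -> o' \in ECpat Pi x D ->
  forall i : J,
  cprob P (I @^-1` [set i]) (O @^-1` [set o])
  <= eta * cprob P (I @^-1` [set i]) (O @^-1` [set o']).

End assumptions.

(* Main.v *)
(* Write a(o,i) = Pr[O = o, I = i].  Uniformity within the class E of the observed
   pattern turns the likelihood-ratio bound into a(o,i) <= eta a(o',i) for o, o' in E;
   summing over the at least k - 1 objects o' <> o of E gives
     a(o,i) <= eta / (eta + k - 1) * Pr[O in E, I = i].
   Given I = i, the adversary outputs o with a probability s(o,i) that does not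
   depend on O, and the s(o,i) sum to at most 1 over E; hence
     Pr[success, O in E, I = i] = sum_(o in E) a(o,i) s(o,i)
                               <= eta / (eta + k - 1) * Pr[O in E, I = i],
   and it remains to sum over the countably many values i. *)
Require Import Defs.
From HB Require Import structures.
From mathcomp Require Import all_boot all_order all_algebra.
From mathcomp Require Import all_classical all_reals all_analysis.
From mathcomp Require Import ring lra.

Import Order.TTheory GRing.Theory Num.Theory.

Local Open Scope classical_set_scope.
Local Open Scope ring_scope.

(** Measurability is asked only of the pieces of [Z] over [E]: the success event will be known to be
    measurable only after it is cut by [O = o] with [o] in the observed class. *)
Lemma fine_measure_fibers (d : measure_display) (Omega : measurableType d)
    (R : realType) (P : probability Omega R) (T : finType) (Y : Omega -> T)
    (E : {set T}) (Z : set Omega) :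
  (forall t, t \in E -> measurable (Z `&` Y @^-1` [set t])) ->
  measurable (Z `&` Y @^-1` [set` E]) /\
  fine (P (Z `&` Y @^-1` [set` E])) =
    \sum_(t in E) fine (P (Z `&` Y @^-1` [set t])).
Proof.
move=> mZY.
have -> : Z `&` Y @^-1` [set` E] =
    \bigcup_(t in [set` E]) (Z `&` Y @^-1` [set t]).
  apply/seteqP; split => [w [Zw EYw]|w [t Et [Zw /= Ywt]]].
    by exists (Y w).
  by split=> //=; rewrite Ywt.
split; first by apply: fin_bigcup_measurable.
rewrite measure_fin_bigcup//; last first.
  by move=> t u _ _ [w [[_ /= <-] [_ /= <-]]].
rewrite -(@bigfs _ _ _ _ (index_enum T)) ?index_enum_uniq//; last first.
  by move=> t _; rewrite mem_index_enum.
by rewrite sum_fine// => t tE; apply/fin_num_measure/mZY.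
Qed.

Arguments fine_measure_fibers {d Omega R} P {T} Y E Z _.

(** An injection of the countable range of [I] into the naturals turns both probabilities into
    series of nonnegative terms, compared term by term. *)
Lemma le_measure_fibers (d : measure_display) (Omega : measurableType d)
    (R : realType) (P : probability Omega R) (J : Type) (I : Omega -> J)
    (c : R) (X Y : set Omega) : countable (range I) ->
  (forall i, measurable (X `&` I @^-1` [set i])) ->
  (forall i, measurable (Y `&` I @^-1` [set i])) ->
  (forall i, fine (P (X `&` I @^-1` [set i])) <=
             c * fine (P (Y `&` I @^-1` [set i]))) ->
  fine (P X) <= c * fine (P Y).
Proof.
move=> /countable_injP[f f_inj] mX mY leXY.
have fI_fiber n : (exists i, I @^-1` (f @^-1` [set n]) = I @^-1` [set i]) \/
    I @^-1` (f @^-1` [set n]) = set0.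
  have [[w fIw]|noI] := pselect (exists w, f (I w) = n); [left|right].
    exists (I w); apply/seteqP; split => v /= fIv; last by rewrite fIv.
    by apply: f_inj; rewrite ?inE ?fIw//.
  by apply/seteqP; split=> // w fIw; apply: noI; exists w.
have mfib Z n : (forall i, measurable (Z `&` I @^-1` [set i])) ->
    measurable (Z `&` I @^-1` (f @^-1` [set n])).
  by move=> mZ; have [[i ->]//|->] := fI_fiber n; rewrite setI0.
have sum_fib Z : (forall i, measurable (Z `&` I @^-1` [set i])) ->
    measurable Z /\
    P Z = (\sum_(0 <= n <oo) P (Z `&` I @^-1` (f @^-1` [set n])))%E.
  move=> mZ.
  have {1 2}-> : Z = \bigcup_n (Z `&` I @^-1` (f @^-1` [set n])).
    by apply/seteqP; split => [w Zw|w [n _ []]//]; exists (f (I w)).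
  split; first by apply: bigcup_measurable => n _; apply: mfib.
  apply: measure_semi_bigcup => [n||].
  - exact: mfib.
  - by move=> n m _ _ [w [[_ /= <-] [_ /= <-]]].
  - by apply: bigcup_measurable => n _; apply: mfib.
have [mX' PX] := sum_fib X mX; have [mY' PY] := sum_fib Y mY.
rewrite -lee_fin EFinM !fineK ?fin_num_measure// PX PY -nneseriesZl//.
apply: lee_nneseries => // n _.
have := mfib _ n mX; have := mfib _ n mY.
have [[i ->]|-> _ _] := fI_fiber n; last by rewrite !setI0 !measure0 mule0.
move=> mYi mXi; have := leXY i; rewrite -lee_fin EFinM !fineK//;
  exact: fin_num_measure.
Qed.

Arguments le_measure_fibers {d Omega R} P {J} I c X Y.

(** The term [u = t] contributes [eta * a t] on the right; each of the at least [k - 1] others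
    contributes at least [a t]. *)
Lemma bounded_ratio_le_sum (R : realFieldType) (T : finType) (E : {set T})
    (a : T -> R) (eta : R) (k : nat) (t : T) :
  (forall u, 0 <= a u) ->
  (forall u v, u \in E -> v \in E -> a u <= eta * a v) ->
  t \in E -> (k <= #|E|)%N ->
  a t * (eta + k%:R - 1) <= eta * \sum_(u in E) a u.
Proof.
move=> a_ge0 ratio tE kE; rewrite (big_setD1 t)//= -addrA mulrDr.
rewrite [X in _ <= X]mulrDr [eta * a t]mulrC lerD2l mulr_sumr.
apply: (@le_trans _ _ (\sum_(u in E :\ t) a t)); last first.
  by apply: ler_sum => u; rewrite in_setD1 => /andP[_ uE]; apply: ratio.
rewrite sumr_const -[a t *+ _]mulr_natr ler_wpM2l//.
by rewrite lerBlDr natr1 ler_nat; move: kE; rewrite (cardsD1 t E) tE.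
Qed.

Theorem theorem1
  (K S T U F L : finType)
  (hK : #|K| = 6%N) (hF : #|F| = 3%N) (hL : #|L| = 3%N)
  (obj : finType) (Pi : obj -> schema K S T U F L)
  (R : realType) (cost : field -> R) (tau : obj -> R)
  (D : {set field})
  (d : measure_display) (Omega : measurableType d) (P : probability Omega R)
  (O : Omega -> obj) (hO : discrete_RV O)
  (J : Type) (I : Omega -> J) (hI : discrete_RV I)
  (eta : R) (heta : 1 <= eta)
  (huniform : uniform_within_EC Pi D (law P O))
  (hratio : bounded_likelihood_ratio Pi D P O I eta)
  (ostar : obj) (hbudget : \sum_(f in D) cost f <= tau ostar)
  (k : nat) (hk0 : (0 < k)%N) (hk : (k <= #|EC Pi (Pi ostar) D|)%N)
  (dW : measure_display) (W : measurableType dW) (seed : {RV P >-> W})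
  (hseed : independent_of_discrete P (fun w => (O w, I w)) seed)
  (A : pattern K S T U F L -> J -> W -> obj)
  (hA : forall x i o, measurable [set v | A x i v = o]) :
  let success := [set w | A (disclose D (Pi (O w))) (I w) (seed w) = O w] in
  let observed := [set w | disclose D (Pi (O w)) = disclose D (Pi ostar)] in
  let delta := eta / (eta + k%:R - 1) - k%:R^-1 in
  [/\ cprob P success observed <= eta / (eta + k%:R - 1),
      delta = (eta - 1) * (k%:R - 1) / (k%:R * (eta + k%:R - 1))
    & cprob P success observed <= k%:R^-1 + delta].
Proof.
move=> success observed delta.
have k_ge1 : 1 <= k%:R :> R by rewrite ler1n.
have k_neq0 : k%:R != 0 :> R by rewrite pnatr_eq0 -lt0n.
have den_gt0 : 0 < eta + k%:R - 1 :> R by lra.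
have den_neq0 : eta + k%:R - 1 != 0 by rewrite gt_eqF.
suff main : cprob P success observed <= eta / (eta + k%:R - 1).
  split=> //; first by rewrite /delta; field; apply/andP.
  by rewrite /delta addrC subrK.
set c := eta / _; have c_ge0 : 0 <= c by rewrite divr_ge0//; lra.
have [[_ mO] [cI mI]] := (hO, hI).
set x := disclose D (Pi ostar) in success observed *.
set E := EC Pi (Pi ostar) D.
have x_disclosed : disclosed_pattern Pi D x by exists ostar.
have inE_E o : (o \in E) = (disclose D (Pi o) == x).
  by rewrite /E /EC /ECpat inE.
have observedE : observed = O @^-1` [set` E].
  by apply/seteqP; split => w /=; rewrite inE_E => /eqP.
have mOI o i : measurable (I @^-1` [set i] `&` O @^-1` [set o]).
  exact: measurableI.
have [mobs Pobs] : measurable observed /\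
    fine (P observed) = \sum_(o in E) fine (P (O @^-1` [set o])).
  have := fine_measure_fibers P O E setT.
  rewrite observedE setTI; under eq_bigr do rewrite setTI; apply.
  by move=> o _; rewrite setTI.
have fine_ge0 B : 0 <= fine (P B) by rewrite fine_ge0.
(* For a null pattern, division by zero makes [cprob] equal to 0, and the bound is just [0 <= c]. *)
have [Pobs0|Pobs_neq0] := eqVneq (fine (P observed)) 0.
  by rewrite /cprob Pobs0 invr0 mulr0.
have Pobs_gt0 : 0 < fine (P observed) by rewrite lt_neqAle eq_sym Pobs_neq0 /=.
have uniformO o o' : o \in E -> o' \in E ->
    fine (P (O @^-1` [set o])) = fine (P (O @^-1` [set o'])).
  move=> oE o'E; have := huniform _ x_disclosed o o' oE o'E.
  rewrite /cprob /law -/observed => /(divIf Pobs_neq0).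
  have fiberE u : u \in E ->
      O @^-1` ([set u] `&` [set a | disclose D (Pi a) = x]) = O @^-1` [set u].
    by rewrite inE_E => /eqP uE; apply/seteqP; split => w /= => [[]|->].
  by rewrite !fiberE.
(* One null object would make the whole class null by uniformity. Positivity lets the common
   denominator in the likelihood ratio be cancelled, giving a bound on joint probabilities. *)
have PO_gt0 o : o \in E -> 0 < fine (P (O @^-1` [set o])).
  move=> oE; rewrite lt_neqAle fine_ge0 andbT eq_sym.
  apply: contra_neq Pobs_neq0 => Po0.
  by rewrite Pobs big1// => u uE; rewrite (uniformO _ o).
pose a i o := fine (P (I @^-1` [set i] `&` O @^-1` [set o])).
have ratio i o o' : o \in E -> o' \in E -> a i o <= eta * a i o'.
  move=> oE o'E; have := hratio x x_disclosed o o' oE o'E i.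
  by rewrite /cprob (uniformO o o')// mulrA ler_pM2r ?invr_gt0 ?PO_gt0.
have a_le i o : o \in E -> a i o <= c * \sum_(u in E) a i u.
  move=> oE; rewrite /c mulrAC ler_pdivlMr//.
  by apply: bounded_ratio_le_sum => // [u|u v]; [exact: fine_ge0|exact: ratio].
(* With the pattern frozen at [x] and the side information at [i], the guess depends on the seed
   alone. *)
pose s i o := fine (P (seed @^-1` [set v | A x i v = o])).
have mseed i o : measurable (seed @^-1` [set v | A x i v = o]).
  by rewrite -[X in measurable X]setTI; apply: measurable_funP.
have s_le1 i : \sum_(o in E) s i o <= 1.
  have [|mS PS] := fine_measure_fibers P (fun w => A x i (seed w)) E setT.
    by move=> o _; rewrite setTI; apply: mseed.
  have -> : \sum_(o in E) s i o = fine (P ([set: Omega] `&`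
      (fun w => A x i (seed w)) @^-1` [set` E])).
    by rewrite PS; apply: eq_bigr => o _; rewrite setTI.
  by rewrite -lee_fin fineK ?fin_num_measure// probability_le1.
(* On [O = o] with [o] in [E] the observed pattern is [x], so success splits into an event of
   [(O, I)] and an event of the seed, to which independence applies. *)
have success_fiber i o : o \in E ->
    success `&` I @^-1` [set i] `&` O @^-1` [set o] =
    (fun w => (O w, I w)) @^-1` [set (o, i)] `&`
      seed @^-1` [set v | A x i v = o].
  rewrite inE_E => /eqP oE; apply/seteqP; split => w /=.
    by rewrite /success /= => -[[Aw <-] Ow]; rewrite Ow oE in Aw *.
  by move=> [[Ow Iw] Aw]; rewrite /success /= Ow Iw oE.
have OI_fiber i o : (fun w => (O w, I w)) @^-1` [set (o, i)] =
    I @^-1` [set i] `&` O @^-1` [set o].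
  by apply/seteqP; split => w /= => [[-> ->]|[-> ->]].
have mobsI i : measurable (observed `&` I @^-1` [set i]) by exact: measurableI.
have Pobs_fiber i :
    fine (P (observed `&` I @^-1` [set i])) = \sum_(o in E) a i o.
  by rewrite observedE setIC; apply: (fine_measure_fibers P O E _ _).2.
have [msucc Psucc] : (forall i, measurable
      (success `&` observed `&` I @^-1` [set i])) /\
    (forall i, fine (P (success `&` observed `&` I @^-1` [set i])) =
      \sum_(o in E) a i o * s i o).
  have fibers i := fine_measure_fibers P O E (success `&` I @^-1` [set i]).
  have mfib i o : o \in E ->
      measurable (success `&` I @^-1` [set i] `&` O @^-1` [set o]).
    by move=> oE; rewrite success_fiber// OI_fiber; apply: measurableI.
  split=> i; rewrite observedE setIAC; have [mZ PZ] := fibers i (mfib i) => //.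
  rewrite PZ; apply: eq_bigr => o oE.
  by rewrite success_fiber// hseed// OI_fiber fineM ?fin_num_measure.
rewrite /cprob ler_pdivrMr//; apply: (le_measure_fibers P I) => // i.
rewrite Psucc Pobs_fiber.
(* The bound on [a i o] is the same for every [o], so it factors out and leaves the sum of the guess
   probabilities, at most 1. *)
apply: (@le_trans _ _ (\sum_(o in E) (c * \sum_(u in E) a i u) * s i o)).
  by apply: ler_sum => o oE; rewrite ler_wpM2r ?fine_ge0 ?a_le.
rewrite -mulr_sumr ler_piMr// mulr_ge0// sumr_ge0// => o _; exact: fine_ge0.
Qed.
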